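(* Let $c \ge 1$ be a fixed integer and let $N = \operatorname{lcm}(1,2,\ldots,c)$. Then there exists a quasipolynomial $f$ of quasiperiod $N$ such that $R(c,a) = f(a)$ for all integers $a \ge 1$ with $a \ge \binom{c}{2}$.
   Context: A finite lattice is graded of rank $3$ if every maximal chain (from bottom to top) has exactly four elements; its elements then lie on four levels: the bottom, the atoms (elements covering the bottom), the coatoms (elements covered by the top), and the top. For integers $c, a \ge 1$, $R(c,a)$ denotes the number of unlabeled graded lattices of rank $3$ (that is, the number of isomorphism classes of such lattices) with exactly $c$ coatoms and exactly $a$ atoms. Let $\mathbb{N}$ denote the set of nonnegative integers. A function $f : \mathbb{N} \to \mathbb{C}$ is a quasipolynomial of quasiperiod $N$ (where $N$ is a positive integer, not required to be minimal) if there are polynomials $P_0, P_1, \ldots, P_{N-1}$ such that for all $n \ge 0$, $f(n) = P_k(n)$ whenever $n \equiv k \pmod N$. *)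

(* Defs.v *)
From HB Require Import structures.
From mathcomp Require Import all_boot all_order all_algebra all_fingroup.
From mathcomp Require Import reals complex.

Set Implicit Arguments.
Unset Strict Implicit.
Unset Printing Implicit Defensive.

Import Order.TTheory GRing.Theory.

(* Isomorphism classes are counted on a fixed finite carrier, so a lattice is   *)
(* represented here by its order relation instead of by an instance of the      *)
(* finLatticeType structure; see lattice_rel_le below.                          *)
Section OrderRelations.

Variables (T : finType) (r : rel T).

Definition order_rel : bool :=
  [&& [forall x, r x x],
      [forall x, forall y, r x y && r y x ==> (x == y)]
    & [forall x, forall y, forall z, r x y && r y z ==> r x z]].

Definition is_join (x y z : T) : bool :=
  [&& r x z, r y z & [forall w, r x w && r y w ==> r z w]].

Definition is_meet (x y z : T) : bool :=
  [&& r z x, r z y & [forall w, r w x && r w y ==> r w z]].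

Definition lattice_rel : bool :=
  order_rel && [forall x, forall y,
    [exists z, is_join x y z] && [exists z, is_meet x y z]].

Definition chain (C : {set T}) : bool :=
  [forall x in C, forall y in C, r x y || r y x].

Definition graded_rank3 : bool :=
  [forall C : {set T}, maxset chain C ==> (#|C| == 4)].

(* y covers x *)
Definition covers (x y : T) : bool :=
  [&& r x y, x != y
    & [forall z, r x z && r z y ==> (z == x) || (z == y)]].

Definition is_bottom (b : T) : bool := [forall x, r b x].
Definition is_top (t : T) : bool := [forall x, r x t].

Definition atoms : {set T} :=
  [set x | [exists b, is_bottom b && covers b x]].

Definition coatoms : {set T} :=
  [set x | [exists t, is_top t && covers x t]].

Definition rank3_lattice (c a : nat) : bool :=
  [&& lattice_rel, graded_rank3, #|coatoms| == c & #|atoms| == a].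

End OrderRelations.

(* Binary relations on T, as a finType of graphs. *)
Definition rel_of (T : finType) (G : {set T * T}) : rel T :=
  [rel x y | (x, y) \in G].

Definition isomorphic (T : finType) (G H : {set T * T}) : bool :=
  [exists p : {perm T}, forall x, forall y,
     rel_of G x y == rel_of H (p x) (p y)].

(* The carrier has c + a + 2 elements: by card_graded_rank3 below, this is the  *)
(* cardinality of every rank 3 lattice with c coatoms and a atoms.              *)
Definition rank3_lattices (c a : nat) : {set {set 'I_(c + a + 2) * 'I_(c + a + 2)}} :=
  [set G | rank3_lattice (rel_of G) c a].

Definition num_rank3_lattices (c a : nat) : nat :=
  #|equivalence_partition (@isomorphic _) (rank3_lattices c a)|.

Definition quasipolynomial (K : nzRingType) (N : nat) (f : nat -> K) : Prop :=
  (0 < N)%N /\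
  exists P : 'I_N -> {poly K},
    forall (n : nat) (k : 'I_N), n = k %[mod N] -> f n = ((P k).[n%:R])%R.

Section Adequacy.

Lemma lattice_rel_le (d : Order.disp_t) (L : finLatticeType d) :
  lattice_rel (fun x y : L => (x <= y)%O).
Proof.
apply/andP; split.
  apply/and3P; split; first by apply/forallP=> x; apply: lexx.
    apply/forallP=> x; apply/forallP=> y; apply/implyP=> xy.
    by apply/eqP/le_anti.
  apply/forallP=> x; apply/forallP=> y; apply/forallP=> z.
  apply/implyP=> /andP[]; exact: le_trans.
apply/forallP=> x; apply/forallP=> y; apply/andP; split; apply/existsP.
  exists (Order.join x y); rewrite /is_join.
  rewrite leUl leUr /=.
  by apply/forallP=> w; apply/implyP; rewrite leUx.
exists (Order.meet x y); rewrite /is_meet.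
rewrite leIl leIr /=.
by apply/forallP=> w; apply/implyP; rewrite lexI.
Qed.

Lemma isomorphic_equiv (T : finType) : equivalence_rel (@isomorphic T).
Proof.
have sym (G H : {set T * T}) : isomorphic G H -> isomorphic H G.
  move=> /existsP[p /forallP pP]; apply/existsP; exists (p^-1)%g.
  apply/forallP=> x; apply/forallP=> y.
  by have /forallP/(_ (p^-1%g y))/eqP-> := pP (p^-1%g x); rewrite !permKV.
have trans (G H K : {set T * T}) :
    isomorphic G H -> isomorphic H K -> isomorphic G K.
  move=> /existsP[p /forallP pP] /existsP[q /forallP qP].
  apply/existsP; exists (p * q)%g; apply/forallP=> x; apply/forallP=> y.
  have /forallP/(_ y)/eqP-> := pP x; have /forallP/(_ (p y))/eqP-> := qP (p x).
  by rewrite !permM.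
move=> G H K; split=> [|GH].
  by apply/existsP; exists 1%g; apply/forallP=> x; apply/forallP=> y; rewrite !perm1.
by apply/idP/idP; [apply: trans (sym _ _ GH) | apply: trans].
Qed.

Variables (T : finType) (r : rel T).
Hypotheses (latr : lattice_rel r) (rk3 : graded_rank3 r).

Let rxx x : r x x.
Proof. by case/andP: latr => /and3P[/forallP/(_ x)]. Qed.

Let ranti x y : r x y -> r y x -> x = y.
Proof.
move=> xy yx; case/andP: latr => /and3P[_ /forallP/(_ x)/forallP/(_ y)].
by rewrite xy yx => /eqP.
Qed.

Let rtrans x y z : r x y -> r y z -> r x z.
Proof.
move=> xy yz; case/andP: latr => /and3P[_ _].
by move=> /forallP/(_ x)/forallP/(_ y)/forallP/(_ z); rewrite xy yz.
Qed.

Let chainP (C : {set T}) :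
  reflect {in C &, forall x y, r x y || r y x} (chain r C).
Proof.
apply: (iffP forallP) => [h x y xC yC | h x].
  by have /implyP/(_ xC)/forallP/(_ y)/implyP/(_ yC) := h x.
by apply/implyP=> xC; apply/forallP=> y; apply/implyP=> yC; apply: h.
Qed.

Let ext4 C : chain r C -> exists2 D : {set T}, C \subset D &
  [/\ #|D| = 4, chain r D &
      forall x, (forall y, y \in D -> r x y || r y x) -> x \in D].
Proof.
move=> /maxset_exists[D mD CD]; exists D => //.
have cD := maxsetp mD; split=> //.
  by move/forallP: rk3 => /(_ D)/implyP/(_ mD)/eqP.
move=> x xD; have cxD : chain r (x |: D).
  apply/chainP=> y z /setU1P[->|yD] /setU1P[->|zD]; rewrite ?rxx //.
  - exact: xD.
  - by rewrite orbC; apply: xD.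
  - by move/chainP: cD; apply.
by rewrite -(maxsetsup mD cxD (subsetUr _ _)) setU11.
Qed.

Lemma card_graded_rank3 : #|T| = #|coatoms r| + #|atoms r| + 2.
Proof.
have [D0 _ [cD0 _ _]] : exists2 D : {set T}, set0 \subset D & [/\ #|D| = 4, chain r D &
    forall x, (forall y, y \in D -> r x y || r y x) -> x \in D].
  by apply: ext4; apply/chainP=> x y; rewrite inE.
have /card_gt0P[x0 _] : 0 < #|D0| by rewrite cD0.
have [b bP] : exists b, forall x, r b x.
  case: (arg_minnP (fun x => #|[set y | r y x]|) (isT : xpredT x0)) => b _ bmin.
  exists b => x; case/andP: latr => _ /forallP/(_ b)/forallP/(_ x)/andP[_].
  move=> /existsP[m /and3P[mb mx _]].
  have sub : [set y | r y m] \subset [set y | r y b].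
    by apply/subsetP=> y; rewrite !inE => /rtrans; apply.
  have /eqP E : [set y | r y m] == [set y | r y b] by rewrite eqEcard sub bmin.
  have : b \in [set y | r y m] by rewrite E inE.
  by rewrite inE => /rtrans; apply.
have [t tP] : exists t, forall x, r x t.
  case: (arg_minnP (fun x => #|[set y | r x y]|) (isT : xpredT x0)) => t _ tmin.
  exists t => x; case/andP: latr => _ /forallP/(_ t)/forallP/(_ x)/andP[].
  move=> /existsP[m /and3P[tm xm _]] _.
  have sub : [set y | r m y] \subset [set y | r t y].
    by apply/subsetP=> y; rewrite !inE; apply: rtrans.
  have /eqP E : [set y | r m y] == [set y | r t y] by rewrite eqEcard sub tmin.
  have : t \in [set y | r m y] by rewrite E inE.
  by rewrite inE; apply: rtrans.
have atomE x : (x \in atoms r) = covers r b x.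
  rewrite inE; apply/existsP/idP => [[b' /andP[/forallP b'P]]|cx].
    by rewrite (ranti (b'P b) (bP b')).
  by exists b; rewrite cx andbT; apply/forallP.
have coatomE x : (x \in coatoms r) = covers r x t.
  rewrite inE; apply/existsP/idP => [[t' /andP[/forallP t'P]]|cx].
    by rewrite (ranti (tP t') (t'P t)).
  by exists t; rewrite cx andbT; apply/forallP.
have through x : exists2 D : {set T}, x \in D & [/\ #|D| = 4, chain r D &
    forall x, (forall y, y \in D -> r x y || r y x) -> x \in D].
  have /ext4[D /subsetP xD hD] : chain r [set x].
    by apply/chainP=> y z /set1P-> /set1P->; rewrite rxx.
  by exists D => //; apply: xD; rewrite inE.
have small x (A : {set T}) : #|A| < 4 ->
    (forall z, r z x || r x z -> z \in A) -> False.
  move=> A4 hA; have [D xD [cD /chainP chD _]] := through x.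
  suff /subset_leq_card : D \subset A by rewrite cD leqNgt A4.
  by apply/subsetP=> z zD; apply: hA; apply: chD.
have bt : b != t.
  apply/eqP=> bt; apply: (small b [set b]); rewrite ?cards1 // => z _.
  by rewrite inE; apply/eqP/ranti => //; rewrite bt.
have nbt : ~~ covers r b t.
  apply/negP=> /and3P[_ _ /forallP h].
  apply: (small b [set b; t]); rewrite ?cards2 ?bt // => z _.
  by rewrite !inE; apply: (implyP (h z)); rewrite bP tP.
have mid x : x != b -> x != t -> covers r b x || covers r x t.
  move=> xb xt; have [D xD [cD /chainP chD Dmax]] := through x.
  have bD : b \in D by apply: Dmax => y _; rewrite bP.
  have tD : t \in D by apply: Dmax => y _; rewrite tP orbT.
  have /eqP/cards1P[y Ey] : #|D :\ b :\ t :\ x| = 1.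
    have := cD; rewrite (cardsD1 b) bD (cardsD1 t) !inE tD eq_sym bt.
    by rewrite (cardsD1 x) !inE xb xt xD => -[].
  have DE z : z \in D -> [|| z == b, z == t, z == x | z == y].
    move=> zD; have := in_set1 z y; rewrite -Ey !inE zD andbT => <-.
    by case: (z == b); case: (z == t); case: (z == x).
  have : y \in [set y] by rewrite inE.
  rewrite -Ey !inE => /and4P[yx0 _ _ yD].
  have [xy|yx] := orP (chD _ _ xD yD).
    apply/orP; left; rewrite /covers bP eq_sym xb /=; apply/forallP=> z.
    rewrite bP /=; apply/implyP=> zx; have zD : z \in D.
      apply: Dmax => w /DE/or4P[]/eqP->; rewrite ?bP ?tP ?zx ?orbT //.
      by rewrite (rtrans zx xy).
    case/or4P: (DE z zD) => [->|/eqP zt|->|/eqP zy] //; rewrite ?orbT //.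
      by case/eqP: xt; apply: ranti => //; rewrite -zt.
    by case/eqP: yx0; apply: ranti => //; rewrite -zy.
  apply/orP; right; rewrite /covers tP xt /=; apply/forallP=> z.
  rewrite tP andbT; apply/implyP=> xz; have zD : z \in D.
    apply: Dmax => w /DE/or4P[]/eqP->; rewrite ?bP ?tP ?xz ?orbT //.
    by rewrite (rtrans yx xz) orbT.
  case/or4P: (DE z zD) => [/eqP zb|->|->|/eqP zy] //; rewrite ?orbT //.
    by case/eqP: xb; apply: ranti => //; rewrite -zb.
  by case/eqP: yx0; apply: ranti => //; rewrite -zy.
have disj x : covers r b x -> covers r x t -> False.
  move=> /and3P[_ _ /forallP h1] /and3P[_ _ /forallP h2].
  apply: (small x [set b; x; t]).
    by rewrite -setUA cardsU1 cards2; case: (_ \notin _); case: (_ != _).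
  move=> z /orP[zx|xz]; rewrite !inE.
    by have := h1 z; rewrite bP zx => /= ->.
  by have := h2 z; rewrite tP xz -orbA => /= ->; rewrite orbT.
have -> : #|T| = #|(coatoms r :|: atoms r) :|: [set b; t]|.
  apply/esym/eqP; rewrite -cardsT eqn_leq subset_leq_card ?subsetT //=.
  apply/subset_leq_card/subsetP=> x _.
  rewrite in_setU in_setU in_set2 atomE coatomE.
  case: (x =P b) => [|/eqP xb]; rewrite ?orbT //.
  case: (x =P t) => [|/eqP xt]; rewrite ?orbT //.
  by rewrite orbC /= orbC mid.
have CA0 : coatoms r :&: atoms r = set0.
  apply/setP=> x; rewrite in_setI atomE coatomE in_set0.
  by apply/negP=> /andP[/[swap]]; apply: disj.
have CAbt0 : (coatoms r :|: atoms r) :&: [set b; t] = set0.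
  apply/setP=> x; rewrite in_setI in_setU in_set2 atomE coatomE in_set0.
  apply/negP=> /andP[/[swap] /orP[]/eqP->];
    by rewrite (negPf nbt) /covers eqxx !andbF.
by rewrite cardsU CAbt0 cardsU CA0 cards2 bt !cards0 !subn0.
Qed.

End Adequacy.

(* Main.v *)
Require Import Defs.
From mathcomp Require Import all_boot all_order all_algebra all_fingroup.
From mathcomp Require Import reals complex.

(* A rank 3 lattice is an incidence structure between atoms and coatoms in
   which two atoms never share two coatoms. The atoms below at least two
   coatoms form a partial linear space L on the c coatoms, of which there
   are finitely many and which has at most 'C(c, 2) lines; the other atoms
   are counted by a weight function m on the coatoms, positive off the
   points of L. Isomorphism classes are thus the orbits of S_c on pairs (L,
   m) with #|L| + sum m = a, and by Burnside it suffices, for s in S_c and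
   L fixed by s, to count the m constant on the cycles of s. Their number
   is the coefficient of x^a in x^#|L| times a product of factors 1 / (1 -
   x^l) or x^l / (1 - x^l), with l running over the cycle lengths of s.
   Over the common denominator (1 - x^N)^k, where k is the number of
   cycles, such a coefficient is quasipolynomial in a as soon as a + k N
   exceeds the degree of the numerator, and this holds for a >= max(1,
   'C(c, 2)). *)

Set Implicit Arguments.
Unset Strict Implicit.
Unset Printing Implicit Defensive.

Import Order.TTheory GRing.Theory Num.Theory.

(** * Quasipolynomials on a set of arguments, and coefficients of rational series *)

Section QuasiPolynomials.

Local Open Scope ring_scope.

(** Restricting to [D] lets many counts share one range of validity while sums and scalings are
    taken. Values off [D] are filled in only at the end, by [quasi_on_extend]. *)
Definition quasi_on (K : nzRingType) (D : pred nat) N (F : nat -> K) : Prop :=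
  exists P : 'I_N -> {poly K},
    forall (n : nat) (k : 'I_N), D n -> n = k %[mod N] -> F n = (P k).[n%:R].

Lemma quasi_onS (K : nzRingType) (D D' : pred nat) N (F : nat -> K) :
  {subset D' <= D} -> quasi_on D N F -> quasi_on D' N F.
Proof. by move=> DD' [P hP]; exists P => n k /DD'; apply: hP. Qed.

Lemma eq_quasi_on (K : nzRingType) (D : pred nat) N (F G : nat -> K) :
  {in D, F =1 G} -> quasi_on D N F -> quasi_on D N G.
Proof. by move=> FG [P hP]; exists P => n k Dn nk; rewrite -FG // (hP n k). Qed.

Lemma quasi_onZ (K : comNzRingType) (D : pred nat) N (c : K) (F : nat -> K) :
  quasi_on D N F -> quasi_on D N (fun n => c * F n).
Proof.
by move=> [P hP]; exists (fun k => c *: P k) => n k Dn nk; rewrite hornerZ (hP n k).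
Qed.

Lemma quasi_on_sum (K : nzRingType) (D : pred nat) N (I : Type) (r : seq I)
    (Q : pred I) (F : I -> nat -> K) :
  (forall i, Q i -> quasi_on D N (F i)) ->
  quasi_on D N (fun n => \sum_(i <- r | Q i) F i n).
Proof.
move=> hF; elim: r => [|i r [P hP]].
  by exists (fun=> 0) => n k _ _; rewrite big_nil horner0.
have [Qi|nQi] := boolP (Q i); last first.
  by exists P => n k Dn nk; rewrite big_cons (negPf nQi) (hP n k).
have [P' hP'] := hF i Qi; exists (fun k => P' k + P k) => n k Dn nk.
by rewrite big_cons Qi hornerD (hP n k) // (hP' n k).
Qed.

Lemma quasi_on_extend (K : nzRingType) (D : pred nat) N (F : nat -> K) :
  (0 < N)%N -> quasi_on D N F ->
  exists f, quasipolynomial N f /\ {in D, F =1 f}.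
Proof.
move=> N0 [P hP].
exists (fun n => (P (Ordinal (ltn_pmod n N0))).[n%:R]); split.
  split=> //; exists P => n k nk; congr (P _).[_]; apply: val_inj.
  by rewrite /= nk modn_small.
by move=> n Dn; apply: hP => //=; rewrite modn_mod.
Qed.

(** The binomial 'C(t + k, k) as a polynomial in t, in factored form so that its roots -1, ..., -k
    are visible. *)
Definition multichoose (K : fieldType) k : {poly K} :=
  (k`!%:R)^-1 *: \prod_(1 <= i < k.+1) ('X + i%:R%:P).

Lemma multichoose_nat (K : numFieldType) k t :
  (multichoose K k).[t%:R] = 'C(t + k, k)%:R.
Proof.
rewrite /multichoose hornerZ horner_prod.
under eq_bigr do rewrite hornerD hornerX hornerC -natrD.
rewrite -natr_prod.
suff -> : (\prod_(1 <= i < k.+1) (t + i) = 'C(t + k, k) * k`!)%N.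
  by rewrite natrM mulrC mulfK // pnatr_eq0 -lt0n fact_gt0.
elim: k => [|k IHk]; first by rewrite big_geq // bin0.
rewrite big_nat_recr //= IHk factS mulnA mulnAC; congr (_ * _)%N.
by rewrite mulnC addnS (mul_bin_diag _ k.+1.-1) mulnC.
Qed.

Lemma multichoose_neg (K : numFieldType) k j :
  (0 < j <= k)%N -> (multichoose K k).[- j%:R] = 0.
Proof.
move=> /andP[j0 jk]; rewrite /multichoose hornerZ horner_prod.
rewrite (bigD1_seq j) ?iota_uniq //=; last by rewrite mem_index_iota j0 ltnS.
by rewrite hornerD hornerX hornerC addNr mul0r mulr0.
Qed.

(** A truncation of 1 / (1 - 'X^l). All series are handled through such polynomials, with [m] large
    enough for the coefficients in question. *)
Definition geom (K : nzRingType) (l m : nat) : {poly K} := \sum_(i < m) 'X^l ^+ i.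

(** Below degree [B] the truncation is not felt, and multiplying by [geom K 1 B] takes partial sums
    of coefficients. The induction on [k] is then the hockey-stick identity. *)
Lemma coef_geom1X (K : comNzRingType) B k t : (t < B)%N ->
  (geom K 1 B ^+ k.+1)`_t = 'C(t + k, k)%:R.
Proof.
have g1 i : (i < B)%N -> (geom K 1 B)`_i = 1.
  move=> iB; have -> : geom K 1 B = \poly_(j < B) 1.
    by rewrite poly_def; apply: eq_bigr => j _; rewrite scale1r -exprM mul1n.
  by rewrite coef_poly iB.
elim: k t => [|k IHk] t tB; first by rewrite bin0 g1.
rewrite exprSr coefM.
under eq_bigr => j _.
  have jt : (j <= t)%N by rewrite -ltnS.
  rewrite IHk ?(leq_ltn_trans jt tB) // g1 ?(leq_ltn_trans (leq_subr _ _) tB) //.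
  rewrite mulr1; over.
rewrite -natr_sum; congr (_%:R); elim: t {tB} => [|t IHt].
  by rewrite big_ord1 !add0n !binn.
by rewrite big_ord_recr /= IHt !addSn binS addnS addnC.
Qed.

(** Multiplied by 'X^l - 1, both sides telescope to the same binomial. With l * d = N this brings a
    factor 1 / (1 - 'X^l) over the denominator 1 - 'X^N. *)
Lemma geomM (K : idomainType) l d B : (0 < l)%N ->
  geom K l (d * B) = geom K l d * geom K (l * d) B.
Proof.
move=> l0; apply: (@mulfI _ ('X^l - 1)).
  by rewrite -size_poly_gt0 size_XnsubC.
rewrite mulrA -!subrX1 -(exprM _ l d) -subrX1; congr (_ - 1).
by rewrite -!exprM mulnA.
Qed.

(** Terms with j > n have degree above n, so any upper bound beyond n gives the same low
    coefficients. The bound e + m makes the sum an exact shift of [geom K l m]. *)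
Lemma coef_shifted_geom (K : comNzRingType) l e m n i :
  (0 < l)%N -> (n < e + m)%N -> (i <= n)%N ->
  (\sum_(j < n.+1 | (e <= j)%N) ('X^l : {poly K}) ^+ j)`_i
    = ('X^(l * e) * geom K l m)`_i.
Proof.
move=> l0 nm i_n; pose F j : {poly K} := 'X^l ^+ j.
have cut k : (n < k)%N ->
    (\sum_(0 <= j < k | (e <= j)%N) F j)`_i
    = (\sum_(0 <= j < n.+1 | (e <= j)%N) F j)`_i.
  move=> nk; rewrite (@big_cat_nat _ _ _ n.+1) //= coefD [X in _ + X]coef_sum.
  rewrite [X in _ + X]big1_seq ?addr0 // => j /andP[_]; rewrite mem_index_iota.
  move=> /andP[nj _]; rewrite /F -exprM coefXn ltn_eqF //.
  by rewrite (leq_ltn_trans i_n) // (leq_trans nj) ?leq_pmull.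
rewrite -(big_mkord (fun j => (e <= j)%N) F) -(cut _ nm).
rewrite (@big_cat_nat _ _ _ e) ?leq_addr //= big1_seq ?add0r; last first.
  move=> j /andP[ej]; rewrite mem_index_iota => /andP[_].
  by rewrite ltnNge ej.
have := @big_addn _ 0 +%R 0 (e + m) e (fun j => e <= j)%N F.
rewrite add0n => ->; rewrite addKn /geom mulr_sumr big_mkord.
rewrite (eq_bigl xpredT) => [|j]; last by rewrite leq_addl.
congr (nth 0 (polyseq _) i); apply: eq_bigr => j _.
by rewrite /F exprD mulrC -exprM.
Qed.

(* The agreement starts k N places below the size of H because the
   polynomial 'C(t + k, k) in t, which gives the coefficients of 1 / (1 -
   x)^(k + 1) for t >= 0, also vanishes at t = -1, ..., -k. The series is
   truncated to [geom K 1 n.+1 ^+ k.+1], which is exact up to degree n. *)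
Lemma quasi_on_coef (K : numFieldType) (H : {poly K}) N k : (0 < N)%N ->
  quasi_on (fun n => size H <= n + k.+1 * N)%N N
    (fun n => (H * (geom K 1 n.+1 ^+ k.+1 \Po 'X^N))`_n).
Proof.
move=> N0.
(* The contribution of the coefficient of [H] at [s]: the polynomial 'C(t + k, k) at t = (n - s) /
   N. It is relevant only when [s] and [n] agree modulo [N]. *)
pose U (k0 : 'I_N) s : {poly K} :=
  H`_s *: (multichoose K k \Po (N%:R^-1 *: ('X - s%:R%:P))).
exists (fun k0 : 'I_N => \sum_(s < size H | s == k0 %[mod N]) U k0 s) => n k0 Dn nk.
rewrite coefM horner_sum.
pose V s := H`_s * (geom K 1 n.+1 ^+ k.+1 \Po 'X^N)`_(n - s).
(* The convolution stops at n and the polynomial side at the size of [H]. Extending by 0 allows both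
   to be compared over a range containing the two. *)
pose W s := if (s <= n)%N then V s else 0.
have -> : \sum_(j < n.+1) H`_j * (geom K 1 n.+1 ^+ k.+1 \Po 'X^N)`_(n - j)
   = \sum_(0 <= j < n.+1 + size H) W j.
  rewrite (@big_cat_nat _ _ _ n.+1) //= ?leq_addr // [X in _ + X]big1_seq.
    by rewrite addr0 big_mkord; apply: eq_bigr => j _; rewrite /W -ltnS ltn_ord.
  move=> j /andP[_]; rewrite mem_index_iota => /andP[nj _].
  by rewrite /W leqNgt nj.
rewrite (@big_cat_nat _ _ _ (size H)) //= ?leq_addl // [X in _ + X]big1_seq.
  rewrite addr0 big_mkord [RHS]big_mkcond; apply: eq_bigr => s _.
  rewrite {}/W {}/V coef_comp_poly_Xn //.
  have Nn0 : N%:R != 0 :> K by rewrite pnatr_eq0 -lt0n.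
  have UE : (U k0 s).[n%:R]
      = H`_s * (multichoose K k).[N%:R^-1 * (n%:R - s%:R)].
    by rewrite hornerZ horner_comp (hornerZ (N%:R^-1)) hornerD hornerN hornerX hornerC.
  case: ifP => [sn|/negbT]; last rewrite -ltnNge => ns.
    rewrite -eqn_mod_dvd // -nk eq_sym; case: eqP => [sk|_]; last by rewrite mulr0.
    rewrite coef_geom1X; last by rewrite ltnS (leq_trans (leq_div _ _)) ?leq_subr.
    rewrite UE -natrB // -multichoose_nat.
    have /dvdnP[q ->] : (N %| n - s)%N by rewrite -eqn_mod_dvd // sk.
    by rewrite mulnK // natrM mulrCA mulVf // mulr1.
  case: eqP => // sk; rewrite UE -opprB -natrB ?(ltnW ns) //.
  have /dvdnP[q qE] : (N %| s - n)%N by rewrite -eqn_mod_dvd ?(ltnW ns) // sk nk.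
  rewrite qE natrM mulrN mulrCA mulVf // mulr1.
  have qk : (q <= k)%N.
    rewrite -ltnS -(ltn_pmul2r N0) -qE ltn_subLR ?(ltnW ns) //.
    exact: leq_trans (ltn_ord s) Dn.
  rewrite multichoose_neg ?mulr0 // qk andbT.
  by move: ns; rewrite -subn_gt0 qE muln_gt0 => /andP[].
move=> j /andP[_]; rewrite mem_index_iota => /andP[hj _].
by rewrite /W /V nth_default // mul0r if_same.
Qed.

End QuasiPolynomials.

(** * Products modulo high degrees, and degree bounds *)

Section LowCoefficients.

Local Open Scope ring_scope.

Lemma low_coefM (K : nzRingType) n (p p' q q' : {poly K}) :
  (forall i, (i <= n)%N -> p`_i = p'`_i) -> (forall i, (i <= n)%N -> q`_i = q'`_i) ->
  forall i, (i <= n)%N -> (p * q)`_i = (p' * q')`_i.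
Proof.
move=> pp' qq' i i_n; rewrite !coefM; apply: eq_bigr => j _.
rewrite pp' ?qq' //; first exact: leq_trans (leq_subr _ _) i_n.
by apply: leq_trans i_n; rewrite -ltnS.
Qed.

Lemma low_coef_prod (K : nzRingType) n (I : finType) (P : pred I) (F G : I -> {poly K}) :
  (forall A, P A -> forall i, (i <= n)%N -> (F A)`_i = (G A)`_i) ->
  forall i, (i <= n)%N -> (\prod_(A | P A) F A)`_i = (\prod_(A | P A) G A)`_i.
Proof.
move=> FG; pose R p q := forall i, (i <= n)%N -> (p : {poly K})`_i = q`_i.
change (R (\prod_(A | P A) F A) (\prod_(A | P A) G A)).
by elim/big_ind2: _ => // p p' q q'; apply: low_coefM.
Qed.

Lemma size_prod_deg (K : nzRingType) (I : finType) (P : pred I) (F : I -> {poly K})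
    (d : I -> nat) :
  (forall A, P A -> size (F A) <= (d A).+1)%N ->
  (size (\prod_(A | P A) F A)%R <= (\sum_(A | P A) d A).+1)%N.
Proof.
move=> Fd; elim/big_ind2: _ => //.
  by rewrite size_poly1.
move=> p m q m' pm qm'; apply: (leq_trans (size_polyMleq _ _)).
by rewrite -ltnS; case: (_ + _)%N (leq_add pm qm') => //= x; rewrite addnS addSn.
Qed.

Lemma size_geom (K : nzRingType) l m :
  (0 < m)%N -> (size (geom K l m) <= (l * m.-1).+1)%N.
Proof.
move=> m0; apply: (leq_trans (size_sum _ _ _)); apply/bigmax_leqP => j _.
by rewrite -exprM size_polyXn ltnS leq_mul2l -ltnS prednK // ltn_ord orbT.
Qed.

End LowCoefficients.

(** * Weight functions constant on the cycles of a permutation *)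

Section InvariantFunctions.

Variables (T : finType) (s : {perm T}).

Lemma mem_porbits i : porbit s i \in porbits s.
Proof. exact: imset_f. Qed.

Lemma sum_porbit (F : {set T} -> nat) :
  \sum_i F (porbit s i) = \sum_(A in porbits s) #|A| * F A.
Proof.
rewrite (partition_big (porbit s) [in porbits s]) => [|i _]; last exact: mem_porbits.
apply: eq_bigr => _ /imsetP[x _ ->].
rewrite (eq_bigr (fun=> F (porbit s x))) => [|i /eqP-> //].
rewrite sum_nat_const; congr (_ * _); apply: eq_card => i.
by rewrite -eq_porbit_mem.
Qed.

(** An invariant [m] is a choice of one value j per cycle A, contributing #|A| * j to the total, and
    expanding the product enumerates these choices. Positivity off [C] becomes j >= 1 on the cycles
    that miss [C]. *)
Lemma card_invariant_fun (K : comNzRingType) (C : {set T}) n t :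
  (forall i, (s i \in C) = (i \in C)) ->
  (#|[set m : {ffun T -> 'I_n.+1} | [&& [forall i, m (s i) == m i],
      [forall i, (i \in C) || (0 < m i)] & \sum_i m i == t]]|%N)%:R%R
  = ((\prod_(A in porbits s)
       \sum_(j < n.+1 | ([disjoint A & C] <= j)%N) ('X^#|A| : {poly K}) ^+ j)`_t)%R.
Proof.
move=> sC.
(* Since [C] is stable under [s], a cycle lies inside [C] or misses it. *)
have porbC i : [disjoint porbit s i & C] = (i \notin C).
  have pC k : ((s ^+ k)%g i \in C) = (i \in C).
    by elim: k => [|k IHk]; rewrite ?expg0 ?perm1 // expgSr permM sC.
  apply/idP/idP => [/disjointFr/(_ (porbit_id s i))-> //|iC].
  rewrite disjoint_subset; apply/subsetP => _ /porbitP[k ->].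
  by rewrite inE pC.
rewrite (big_distr_big_dep ord0) coef_sum.
under eq_bigr => w _.
  have -> : (\prod_(A in porbits s) 'X^#|A| ^+ w A
      = 'X^(\sum_(A in porbits s) #|A| * w A) :> {poly K})%R.
    rewrite (big_morph _ (exprD 'X%R) (expr0 _)).
    by apply: eq_bigr => A _; rewrite exprM.
  rewrite coefXn; over.
rewrite -natr_sum; congr (_%:R)%R.
rewrite (eq_bigr (fun w : {ffun {set T} -> 'I_n.+1} =>
  if t == \sum_(A in porbits s) #|A| * w A then 1 else 0)); last first.
  by move=> w _; case: eqP.
rewrite -big_mkcondr sum1dep_card.
(* [f] turns values on cycles into values on points. It is injective here because the choices [w]
   vanish on every set that is not a cycle. *)
pose f (w : {ffun {set T} -> 'I_n.+1}) := [ffun i => w (porbit s i)].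
rewrite -(@card_in_imset _ _ f); last first.
  move=> w w'; rewrite !inE => /andP[/pfamilyP[/supportP w0 _] _].
  move=> /andP[/pfamilyP[/supportP w'0 _] _] /ffunP ww'.
  apply/ffunP => A; have [/imsetP[i _ ->]|nA] := boolP (A \in porbits s).
    by have := ww' i; rewrite !ffunE.
  by rewrite w0 ?w'0.
apply: eq_card => m; rewrite inE; apply/and3P/imsetP => [[minv mC msum]|[w]].
  have mporb i j : porbit s i = porbit s j -> m i = m j.
    move=> ij; have /porbitP[k ->] : i \in porbit s j.
      by rewrite -eq_porbit_mem ij.
    by elim: k => [|k <-]; rewrite ?expg0 ?perm1 // expgSr permM (eqP (forallP minv _)).
  pose w := [ffun A => if [pick i | porbit s i == A] is Some i then m i else ord0].
  have wE i : w (porbit s i) = m i.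
    rewrite ffunE; case: pickP => [j /eqP/mporb //|/(_ i)]; by rewrite eqxx.
  exists w; last by apply/ffunP => i; rewrite ffunE wE.
  rewrite inE -sum_porbit; under eq_bigr do rewrite wE.
  rewrite eq_sym msum andbT; apply/pfamilyP; split.
    apply/supportP => A nA; rewrite ffunE; case: pickP => // i /eqP Ai.
    by rewrite -Ai mem_porbits in nA.
  move=> _ /imsetP[i _ ->]; rewrite unfold_in wE porbC.
  by have := forallP mC i; case: (i \in C).
rewrite inE => /andP[/pfamilyP[_ wQ]]; rewrite -sum_porbit => /eqP wt ->.
split.
- apply/forallP => i; rewrite !ffunE; apply/eqP; congr (w _).
  by have := porbit_perm s 1 i; rewrite expg1.
- apply/forallP => i; rewrite ffunE.
  have : [disjoint porbit s i & C] <= w (porbit s i) by exact: wQ _ (mem_porbits i).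
  by rewrite porbC; case: (i \in C).
- by rewrite wt; apply/eqP/eq_bigr => i _; rewrite ffunE.
Qed.

End InvariantFunctions.

(** [l] stands for the number of lines, which are part of the total. Bounding the values by [a]
    loses nothing, as their sum is at most [a]. *)
Definition invariant_weights (T : finType) (s : {perm T}) (C : {set T}) l a :=
  [set m : {ffun T -> 'I_a.+1} | [&& [forall i, m (s i) == m i],
    [forall i, (i \in C) || (0 < m i)] & l + \sum_i m i == a]].

(** Over the denominator (1 - 'X^N)^k, with k the number of cycles, each cycle adds at most N to the
    degree of the numerator, which is thus at most l + k * N. This settles a >= l + 1. If [C] is
    nonempty, a cycle inside it adds less than N, and a >= l suffices. *)
Lemma quasi_on_invariant_weights (K : numFieldType) (T : finType) (s : {perm T})
    (C : {set T}) l N (D : pred nat) :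
  0 < N -> {in porbits s, forall A : {set T}, #|A| %| N} -> 0 < #|T| ->
  (forall i, (s i \in C) = (i \in C)) ->
  (forall a, D a -> l + (C == set0) <= a) ->
  quasi_on D N (fun a => #|invariant_weights s C l a|%:R%R : K).
Proof.
move=> N0 porbN T0 sC hD; pose P := porbits s.
pose e (A : {set T}) : nat := [disjoint A & C].
have porb0 A : A \in P -> 0 < #|A|.
  by move=> /imsetP[i _ ->]; rewrite lt0n card_porbit_neq0.
have k0 : 0 < #|P|.
  have [x _] := card_gt0P T0; apply/card_gt0P; exists (porbit s x).
  exact: mem_porbits.
(* The numerator: 1 / (1 - 'X^d) is [geom K d (N %/ d)] over 1 - 'X^N for each cycle length d. *)
pose H : {poly K} := ('X^l *
   \prod_(A in P) ('X^(#|A| * e A) * geom K #|A| (N %/ #|A|)))%R.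
apply: (@eq_quasi_on _ _ _ (fun n => (H * (geom K 1 n.+1 ^+ #|P| \Po 'X^N))`_n)%R).
  (* By [geomM], [M A] is the length of the truncation obtained when the factor of [A] absorbs one
     copy of [geom K N a.+1]. It is at least a + 1, so degrees up to a are exact. *)
  move=> a _; pose M (A : {set T}) := (N %/ #|A|) * a.+1.
  have -> : (H * (geom K 1 a.+1 ^+ #|P| \Po 'X^N)
      = 'X^l * \prod_(A in P) ('X^(#|A| * e A) * geom K #|A| (M A)))%R.
    rewrite -mulrA; congr (_ * _)%R.
    have -> : (geom K 1 a.+1 ^+ #|P| \Po 'X^N = \prod_(A in P) geom K N a.+1)%R.
      rewrite prodr_const rmorphXn /=; congr (_ ^+ _)%R.
      rewrite rmorph_sum /=; apply: eq_bigr => j _.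
      by rewrite rmorphXn /= expr1 comp_polyX.
    rewrite -big_split /=; apply: eq_bigr => A PA.
    by rewrite -mulrA /M geomM ?porb0 // [(#|A| * (_ %/ _))%N]mulnC divnK ?porbN.
  rewrite coefXnM; case: ltnP => [al|la].
    rewrite (_ : invariant_weights _ _ _ _ = set0) ?cards0 //.
    apply/setP => m; rewrite !inE; apply/negbTE/negP => /and3P[_ _ /eqP E].
    by move: al; rewrite -{1}E ltnNge leq_addr.
  have low A : A \in P -> forall i, i <= a ->
      (('X^(#|A| * e A) * geom K #|A| (M A))`_i =
       (\sum_(j < a.+1 | (e A <= j)%N) ('X^#|A| : {poly K}) ^+ j)`_i)%R.
    move=> PA i i_a; rewrite (@coef_shifted_geom _ _ _ (M A)) ?porb0 //.
    rewrite -addn1 addnC; apply: leq_trans (leq_addl _ _); rewrite add1n.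
    by rewrite leq_pmull // divn_gt0 ?porb0 // dvdn_leq ?porbN.
  rewrite (low_coef_prod low) ?leq_subr // -(card_invariant_fun _ _ _ sC).
  congr (#|pred_of_set _|%:R)%R; apply/setP => m; rewrite !inE.
  by rewrite -[X in l + _ == X](subnKC la) eqn_add2l.
rewrite -(prednK k0).
apply: quasi_onS (quasi_on_coef H _ N0) => a Da; rewrite unfold_in /= prednK //.
have szH : size H <= (l + \sum_(A in P) (#|A| * e A + (N - #|A|))).+1.
  apply: (leq_trans (size_polyMleq _ _)); rewrite size_polyXn addSn /=.
  rewrite -addnS leq_add2l; apply: size_prod_deg => A PA.
  apply: (leq_trans (size_polyMleq _ _)); rewrite size_polyXn addSn /= -addnS.
  rewrite leq_add2l; apply: (leq_trans (size_geom _ _ _)).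
    by rewrite divn_gt0 ?porb0 // dvdn_leq ?porbN.
  by rewrite ltnS -subn1 mulnBr muln1 mulnC divnK ?porbN.
apply: (leq_trans szH).
have leN A : A \in P -> #|A| * e A + (N - #|A|) <= N.
  move=> PA; rewrite -[leqRHS](subnKC (dvdn_leq N0 (porbN _ PA))) leq_add2r.
  by rewrite /e; case: [disjoint _ & _]; rewrite ?muln1 ?muln0.
have la := hD _ Da.
have [C0|/set0Pn[x Cx]] := eqVneq C set0.
  rewrite C0 eqxx addn1 in la; rewrite -addSn leq_add //.
  by rewrite -sum_nat_const leq_sum.
(* The cycle of [x] meets [C], so it adds N - #|A| instead of N, which saves the required unit. *)
have Px := mem_porbits s x.
have ex : e (porbit s x) = 0.
  rewrite /e; case: disjoint (@disjointFr _ (pred_of_set (porbit s x)) C) => // /(_ x).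
  by rewrite porbit_id Cx => /(_ isT isT).
rewrite -addnS; apply: leq_add; first by apply: leq_trans la; apply: leq_addr.
rewrite -sum_nat_const (bigD1 (porbit s x)) //= [leqRHS](bigD1 (porbit s x)) //=.
rewrite -addSn leq_add //; last by apply: leq_sum => A /andP[PA _]; apply: leN.
rewrite ex muln0 add0n ltn_subrL N0 andbT; exact: porb0.
Qed.

(** * Weighted linear spaces and the Burnside count of their orbits *)

Section Models.

Variable T : finType.
Implicit Types (s t : {perm T}) (L : {set {set T}}).

(** A partial linear space in the usual terminology: two points may lie on no common line. *)
Definition linear_space L : bool :=
  [forall S in L, 1 < #|S|] &&
  [forall S in L, forall S' in L, (S != S') ==> (#|S :&: S'| <= 1)].

Lemma linear_spaceP (L : {set {set T}}) :
  reflect ((forall S, S \in L -> 1 < #|S|) /\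
           (forall S S', S \in L -> S' \in L -> S != S' -> #|S :&: S'| <= 1))
          (linear_space L).
Proof.
apply: (iffP andP) => -[h1 h2]; split.
- by move=> S SL; apply: (forall_inP h1).
- move=> S S' SL S'L; apply/implyP.
  exact: (forall_inP (forall_inP h2 S SL)).
- exact/forall_inP.
- by apply/forall_inP => S SL; apply/forall_inP => S' S'L; apply/implyP; apply: h2.
Qed.

(** Choosing two points on each line is injective, since distinct lines share at most one point. *)
Lemma card_linear_space L : linear_space L -> #|L| <= 'C(#|T|, 2).
Proof.
move=> /linear_spaceP[L1 L2].
pose f (S : {set T}) := odflt set0 [pick A : {set T} | (A \subset S) && (#|A| == 2)].
have fP S : S \in L -> (f S \subset S) && (#|f S| == 2).
  move=> /L1/card_gt1P[x [y [xS yS xy]]]; rewrite /f; case: pickP => //=.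
  move/(_ [set x; y]); rewrite cards2 xy subUset !sub1set xS yS //.
rewrite -card_draws; have <- : #|f @: L| = #|L|.
  apply: card_in_imset => S S' SL S'L ff.
  have [//|SS'] := eqVneq S S'.
  have [/andP[sub /eqP f2] /andP[sub' _]] := (fP S SL, fP S' S'L).
  have := L2 _ _ SL S'L SS'; rewrite leqNgt -f2 subset_leq_card //.
  by rewrite subsetI sub ff sub'.
apply/subset_leq_card/subsetP => _ /imsetP[S /fP/andP[_ fS] ->].
by rewrite inE.
Qed.

Definition perm_lines s L : {set {set T}} :=
  [set s @: (S : {set T}) | S in L].

Lemma perm_lines1 L : perm_lines 1 L = L.
Proof.
rewrite /perm_lines -[RHS]imset_id; apply: eq_imset => S.
by rewrite -[RHS]imset_id; apply: eq_imset => x; rewrite perm1.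
Qed.

Lemma perm_linesM s t L : perm_lines (s * t) L = perm_lines t (perm_lines s L).
Proof.
rewrite /perm_lines -imset_comp; apply: eq_imset => S /=.
by rewrite -imset_comp; apply: eq_imset => x /=; rewrite permM.
Qed.

Lemma card_perm_lines s L : #|perm_lines s L| = #|L|.
Proof. by apply: card_imset; apply/imset_inj/perm_inj. Qed.

Lemma mem_cover_perm_lines s L i : (s i \in cover (perm_lines s L)) = (i \in cover L).
Proof.
by rewrite -[RHS](mem_imset _ _ (@perm_inj _ s)) imset_cover cover_imset.
Qed.

Lemma linear_space_perm s L : linear_space L -> linear_space (perm_lines s L).
Proof.
move=> /linear_spaceP[L1 L2]; apply/linear_spaceP; split.
  move=> _ /imsetP[S SL ->]; rewrite card_imset; [exact: L1 | exact: perm_inj].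
move=> _ _ /imsetP[S SL ->] /imsetP[S' S'L ->] SS'.
rewrite -imsetI => [|x y _ _]; last exact: perm_inj.
rewrite card_imset; last exact: perm_inj.
by apply: L2 => //; apply: contraNneq SS' => ->.
Qed.

Definition model a := ({set {set T}} * {ffun T -> 'I_a.+1})%type.

(* A lattice with point set T of coatoms: the first component records the
   atoms below at least two coatoms, the second one the number of atoms
   below exactly one given coatom. *)
Definition models a : {set model a} :=
  [set x : model a | [&& linear_space x.1, [forall i, (i \in cover x.1) || (0 < x.2 i)]
             & #|x.1| + \sum_i x.2 i == a]].

(** The inverse moves the weight of [i] to [s i], so that weights follow their points. *)
Definition model_perm a (x : model a) (s : {perm T}) : model a :=
  (perm_lines s x.1, [ffun i => x.2 (s^-1%g i)]).

Lemma model_perm_is_action a : is_action [set: {perm T}] (@model_perm a).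
Proof.
apply: is_total_action => [[L m]|[L m] s t]; rewrite /model_perm /=.
  by rewrite perm_lines1; congr (_, _); apply/ffunP => i; rewrite ffunE invg1 perm1.
rewrite perm_linesM; congr (_, _); apply/ffunP => i.
by rewrite !ffunE invMg permM.
Qed.

Canonical model_action a := Action (@model_perm_is_action a).

Lemma acts_on_models a : [acts [set: {perm T}], on models a | model_action a].
Proof.
apply/subsetP => s _; rewrite inE in_setT inE; apply/subsetP => -[L m].
rewrite !inE /= => /and3P[linL covL /eqP sumL]; apply/and3P; split.
- exact: linear_space_perm.
- apply/forallP => i; rewrite ffunE -[i in i \in _](permKV s) mem_cover_perm_lines.
  exact: (forallP covL).
- rewrite card_perm_lines -[X in _ == X]sumL eqn_add2l; apply/eqP.
  rewrite [RHS](reindex_inj (@perm_inj _ s^-1%g)).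
  by apply: eq_bigr => i _; rewrite ffunE.
Qed.

Lemma card_fixed_models a s :
  #|('Fix_(models a | model_action a)[s])%g| =
  \sum_(L | linear_space L && (perm_lines s L == L))
     #|invariant_weights s (cover L) #|L| a|.
Proof.
under [RHS]eq_bigr do rewrite -sum1_card.
rewrite pair_big_dep sum1dep_card; apply: eq_card => -[L m].
rewrite inE (sameP afix1P eqP) !inE /= xpair_eqE.
rewrite -!andbA; congr (_ && _).
have -> : ([ffun i => m (s^-1%g i)] == m) = [forall i, m (s i) == m i].
  apply/eqP/forallP => [/ffunP mE i|mE].
    by rewrite -{1}mE ffunE permK.
  by apply/ffunP => i; rewrite ffunE -(eqP (mE _)) permKV.
by case: (_ == L); case: [forall i, m (s i) == m i]; rewrite ?andbT ?andbF.
Qed.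

(** By Burnside the count is an average of fixed-point counts. These split into sums over [s] and
    [L] whose index sets do not depend on [a], so the previous result applies term by term. *)
Lemma quasi_on_orbits (K : numFieldType) N :
  0 < N -> 0 < #|T| -> (forall l, 0 < l <= #|T| -> l %| N) ->
  quasi_on (fun a => (0 < a) && ('C(#|T|, 2) <= a)) N
    (fun a => #|[set orbit (model_action a) [set: {perm T}] x | x in models a]|%:R%R : K).
Proof.
move=> N0 T0 hN.
apply: (@eq_quasi_on _ _ _ (fun a => (#|[set: {perm T}]|%:R)^-1 *
  \sum_(s in [set: {perm T}]) \sum_(L | linear_space L && (perm_lines s L == L))
     #|invariant_weights s (cover L) #|L| a|%:R)%R).
  move=> a _ /=.
  under eq_bigr do rewrite -natr_sum -card_fixed_models.
  rewrite -natr_sum (Frobenius_Cauchy (acts_on_models a)) natrM mulrC mulfK //.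
  by rewrite pnatr_eq0 -lt0n cardG_gt0.
apply: quasi_onZ; apply: quasi_on_sum => s _; apply: quasi_on_sum => L.
move=> /andP[linL /eqP sL]; apply: quasi_on_invariant_weights => //.
- move=> _ /imsetP[i _ ->]; apply: hN.
  by rewrite lt0n card_porbit_neq0 max_card.
- by move=> i; rewrite -{1}sL mem_cover_perm_lines.
(* The two conditions on [a] serve two cases: for [L] empty the requirement is 1 <= a, while a
   nonempty [L] covers a point and only #|L| <= a is required. *)
- move=> a /andP[a0 ca]; have la := leq_trans (card_linear_space linL) ca.
  have [-> |/set0Pn[S SL]] := eqVneq L set0.
    by rewrite cards0 add0n; case: eqP.
  case: eqVneq => [cL0|_]; last by rewrite addn0.
  have /linear_spaceP[/(_ _ SL)] := linL.
  have : S \subset cover L by apply: bigcup_sup.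
  by rewrite cL0 subset0 => /eqP ->; rewrite cards0.
Qed.

End Models.

(** * Rank 3 lattices built from incidence structures *)

Section Incidence.

Variables C J : finType.

Definition ranked : finType := option (option (C + J)).

Definition bot : ranked := None.
Definition top : ranked := Some None.
Definition coat i : ranked := Some (Some (inl i)).
Definition atom j : ranked := Some (Some (inr j)).

Definition inc_le (h : J -> {set C}) (x y : ranked) : bool :=
  match x, y with
  | None, _ | _, Some None => true
  | _, None | Some None, _ => false
  | Some (Some (inl i)), Some (Some (inl i')) => i == i'
  | Some (Some (inl i)), Some (Some (inr j)) => false
  | Some (Some (inr j)), Some (Some (inl i)) => i \in h j
  | Some (Some (inr j)), Some (Some (inr j')) => j == j'
  end.

Arguments inc_le h x y : simpl nomatch.

(** The first two clauses let every maximal chain pass through an atom and a coatom. The third makes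
    a common coatom of two atoms unique, and dually, which yields joins and meets. *)
Definition incidence (h : J -> {set C}) : Prop :=
  [/\ forall j, exists i, i \in h j, forall i, exists j, i \in h j &
      forall j j' i i', i \in h j -> i \in h j' -> i' \in h j -> i' \in h j' ->
        (j == j') || (i == i')].

Definition presents (T : finType) (r : rel T) (h : J -> {set C}) (f : ranked -> T) :=
  bijective f /\ forall x y, r (f x) (f y) = inc_le h x y.

Lemma rankedP (P : ranked -> Prop) :
  P bot -> P top -> (forall i, P (coat i)) -> (forall j, P (atom j)) -> forall x, P x.
Proof. by move=> Pb Pt Pc Pa [[[i|j]|]|]; [apply: Pc | apply: Pa | |]. Qed.

Section Presented.

Variables (T : finType) (r : rel T) (h : J -> {set C}) (f : ranked -> T).
Hypotheses (C0 : 0 < #|C|) (hP : incidence h) (fP : presents r h f).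

Let fle x y : r (f x) (f y) = inc_le h x y. Proof. by case: fP. Qed.

Let finj : injective f. Proof. by case: fP => /bij_inj. Qed.

Let fsurj (P : T -> Prop) : (forall x, P (f x)) -> forall x, P x.
Proof. by case: fP => -[g _ gK] _ Pf x; rewrite -[x]gK. Qed.

(** Only incomparable pairs need an argument. Two atoms join at their common coatom, if any, and
    otherwise at the top; every other incomparable pair joins at the top. Meets are dual. *)
Lemma presented_lattice : lattice_rel r.
Proof.
have [h1 h2 h3] := hP.
apply/andP; split.
  apply/and3P; split.
  - apply/forallP; apply: fsurj => x; rewrite fle.
    by elim/rankedP: x => //= ?; rewrite eqxx.
  - apply/forallP; apply: fsurj => x; apply/forallP; apply: fsurj => y.
    rewrite !fle (inj_eq finj).
    by elim/rankedP: x => [||i|j]; elim/rankedP: y => [||i'|j'] //=;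
      apply/implyP => /andP[] // /eqP ->.
  - apply/forallP; apply: fsurj => x; apply/forallP; apply: fsurj => y.
    apply/forallP; apply: fsurj => z; rewrite !fle.
    elim/rankedP: x => [||i|j]; elim/rankedP: y => [||i'|j'];
      elim/rankedP: z => [||i''|j''] //=; rewrite ?implybT //; apply/implyP => /andP[] //.
    + by move=> /eqP->.
    + by move=> ? /eqP<-.
    + by move=> /eqP->.
    + by move=> /eqP->.
apply/forallP; apply: fsurj => x; apply/forallP; apply: fsurj => y; apply/andP; split.
  have [z zP] : exists z, [&& inc_le h x z, inc_le h y z &
      [forall w, inc_le h x w && inc_le h y w ==> inc_le h z w]].
    have [xy|xy] := boolP (inc_le h x y).
      exists y; rewrite xy andTb; apply/andP; split; first by elim/rankedP: (y) => //= ?.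
      by apply/forallP => w; apply/implyP => /andP[].
    have [yx|yx] := boolP (inc_le h y x).
      exists x; rewrite yx andTb; apply/andP; split; first by elim/rankedP: (x) => //= ?.
      by apply/forallP => w; apply/implyP => /andP[].
    elim/rankedP: x xy yx => [||i|j] //; elim/rankedP: y => [||i'|j'] //= xy yx.
    - exists top; rewrite /=; apply/forallP; elim/rankedP => //= k.
      by apply/implyP => /andP[/eqP ki /eqP k'i]; rewrite ki k'i eqxx in xy.
    - exists top; rewrite /=; apply/forallP; elim/rankedP => //= k.
      by apply/implyP => /andP[/eqP <- ii]; rewrite ii in yx.
    - exists top; rewrite /=; apply/forallP; elim/rankedP => //= k.
        by apply/implyP => /andP[ii /eqP ki]; rewrite ki ii in xy.
      by rewrite andbF.
    case: (pickP (fun i => (i \in h j) && (i \in h j'))) => [i /andP[ij ij']|none].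
      exists (coat i); rewrite /= ij ij' /=; apply/forallP; elim/rankedP => //= k.
        apply/implyP => /andP[kj kj'].
        by have := h3 _ _ _ _ ij ij' kj kj'; rewrite (negPf xy).
      by apply/implyP => /andP[/eqP jk /eqP jk']; rewrite jk jk' eqxx in xy.
    exists top; rewrite /=; apply/forallP; elim/rankedP => //= k.
      by rewrite none.
    by apply/implyP => /andP[/eqP jk /eqP jk']; rewrite jk jk' eqxx in xy.
  apply/existsP; exists (f z); rewrite /is_join !fle.
  case/and3P: zP => -> -> /forallP zP /=; apply/forallP; apply: fsurj => w.
  by rewrite !fle zP.
have [z zP] : exists z, [&& inc_le h z x, inc_le h z y &
    [forall w, inc_le h w x && inc_le h w y ==> inc_le h w z]].
  have [xy|xy] := boolP (inc_le h x y).
    exists x; rewrite xy andTb; apply/andP; split; first by elim/rankedP: (x) => //= ?.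
    by apply/forallP => w; apply/implyP => /andP[].
  have [yx|yx] := boolP (inc_le h y x).
    exists y; rewrite yx andTb; apply/andP; split; first by elim/rankedP: (y) => //= ?.
    by apply/forallP => w; apply/implyP => /andP[].
  elim/rankedP: x xy yx => [||i|j] //; elim/rankedP: y => [||i'|j'] //= xy yx.
  - case: (pickP (fun j => (i \in h j) && (i' \in h j))) => [j /andP[ij ij']|none].
      exists (atom j); rewrite /= ij ij' /=; apply/forallP; elim/rankedP => //= k.
        by apply/implyP => /andP[/eqP jk /eqP jk']; rewrite -jk -jk' eqxx in xy.
      apply/implyP => /andP[kj kj'].
      by have := h3 _ _ _ _ ij kj ij' kj'; rewrite (negPf xy) orbF eq_sym.
    exists bot; rewrite /=; apply/forallP; elim/rankedP => //= k.
      by apply/implyP => /andP[/eqP jk /eqP jk']; rewrite -jk -jk' eqxx in xy.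
    by rewrite none.
  - exists bot; rewrite /=; apply/forallP; elim/rankedP => //= k.
      by rewrite andbF.
    by apply/implyP => /andP[ii /eqP ki]; rewrite -ki ii in yx.
  - exists bot; rewrite /=; apply/forallP; elim/rankedP => //= k.
    by apply/implyP => /andP[/eqP -> ii]; rewrite ii in xy.
  exists bot; rewrite /=; apply/forallP; elim/rankedP => //= k.
  by apply/implyP => /andP[/eqP jk /eqP jk']; rewrite -jk -jk' eqxx in xy.
apply/existsP; exists (f z); rewrite /is_meet !fle.
case/and3P: zP => -> -> /forallP zP /=; apply/forallP; apply: fsurj => w.
by rewrite !fle zP.
Qed.

(** A coatom from [C] lies strictly between bottom and top, and each atom has some coatom above it,
    so neither the bottom nor an atom is covered by the top. *)
Lemma presented_coatoms : coatoms r = [set f (coat i) | i in C].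
Proof.
have [h1 h2 _] := hP.
apply/setP; apply: fsurj => x; rewrite inE.
have -> : [exists t, is_top r t && covers r (f x) t] = covers r (f x) (f top).
  apply/existsP/idP => [[t] | cx]; last first.
    exists (f top); rewrite cx andbT; apply/forallP; apply: fsurj => z.
    by rewrite fle; case: z => [[[]|]|].
  elim/fsurj: t => t /andP[/forallP/(_ (f top))]; rewrite fle.
  by elim/rankedP: t.
rewrite /covers fle (inj_eq finj); apply/and3P/imsetP => [[_ xt /forallP xP]|[i _]].
  elim/rankedP: x xt xP => [||i|j] // _ xP; last 2 first.
  - by exists i.
  - by have [i ij] := h1 j; have := xP (f (coat i)); rewrite !fle !(inj_eq finj) /= ij.
  by have [i _] := card_gt0P C0; have := xP (f (coat i)); rewrite !fle !(inj_eq finj).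
move=> /finj ->; split=> //; apply/forallP; apply: fsurj => z.
rewrite !fle !(inj_eq finj); elim/rankedP: z => [||k|k] //=.
by apply/implyP => /andP[/eqP -> _]; rewrite eqxx.
Qed.

Lemma presented_atoms : atoms r = [set f (atom j) | j in J].
Proof.
have [h1 h2 _] := hP.
apply/setP; apply: fsurj => x; rewrite inE.
have -> : [exists b, is_bottom r b && covers r b (f x)] = covers r (f bot) (f x).
  apply/existsP/idP => [[b] | cx]; last first.
    exists (f bot); rewrite cx andbT; apply/forallP; apply: fsurj => z.
    by rewrite fle.
  elim/fsurj: b => b /andP[/forallP/(_ (f bot))]; rewrite fle.
  by elim/rankedP: b.
rewrite /covers fle (inj_eq finj); apply/and3P/imsetP => [[_ xb /forallP xP]|[j _]].
  elim/rankedP: x xb xP => [||i|j] // _ xP; last 2 first.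
  - by have [j ij] := h2 i; have := xP (f (atom j)); rewrite !fle !(inj_eq finj) /= ij.
  - by exists j.
  by have [i _] := card_gt0P C0; have := xP (f (coat i)); rewrite !fle !(inj_eq finj).
move=> /finj ->; split=> //; apply/forallP; apply: fsurj => z.
rewrite !fle !(inj_eq finj); elim/rankedP: z => [||k|k] //=.
by apply/implyP => /eqP ->; rewrite eqxx.
Qed.

(** Distinct elements of one level are incomparable, so a chain has at most one atom and one coatom.
    A chain lacking either could be enlarged by an incident one. *)
Lemma presented_graded : graded_rank3 r.
Proof.
have [h1 h2 _] := hP.
apply/forallP => A; apply/implyP => mA.
(* The maximal chain is pulled back to [ranked], where comparisons compute. *)
pose D := f @^-1: A.
have Dch x y : x \in D -> y \in D -> inc_le h x y || inc_le h y x.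
  rewrite !inE -!fle; have /forall_inP/(_ (f x)) := maxsetp mA.
  by move=> + xA yA => /(_ xA)/forall_inP/(_ _ yA).
have Dmax x : (forall y, y \in D -> inc_le h x y || inc_le h y x) -> x \in D.
  move=> xD; rewrite inE -(maxsetsup mA _ (subsetUr [set f x] A)) ?setU11 //.
  have xA : forall y, y \in A -> r (f x) y || r y (f x).
    by apply: fsurj => y yA; rewrite !fle xD // inE.
  apply/forall_inP => y /setU1P[->|yA]; apply/forall_inP => z /setU1P[->|zA].
  - by have /andP[/and3P[/forallP/(_ (f x)) -> _ _] _] := presented_lattice.
  - exact: xA.
  - by rewrite orbC; apply: xA.
  - by have /forall_inP/(_ _ yA)/forall_inP/(_ _ zA) := maxsetp mA.
have bD : bot \in D by apply: Dmax.
have tD : top \in D by apply: Dmax => -[[[]|]|].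
have coatD : exists i, coat i \in D.
  case: (pickP (fun j => atom j \in D)) => [j jD|noatom].
    have [i ij] := h1 j; case: (pickP (fun i => coat i \in D)) => [i' i'D|nocoat].
      by exists i'.
    exists i; apply: Dmax; elim/rankedP => // [k|k kD]; first by rewrite nocoat.
    by have := Dch _ _ jD kD; rewrite /= eq_sym orbb => /eqP ->.
  case: (pickP (fun i => coat i \in D)) => [i' i'D|nocoat]; first by exists i'.
  have [i _] := card_gt0P C0; exists i; apply: Dmax; elim/rankedP => // k.
    by rewrite nocoat.
  by rewrite noatom.
have [i iD] := coatD.
have atomD : exists j, atom j \in D.
  case: (pickP (fun j => atom j \in D)) => [j jD|noatom]; first by exists j.
  have [j ij] := h2 i; exists j; apply: Dmax; elim/rankedP => // k.
    by move=> kD; have := Dch _ _ iD kD; rewrite /= eq_sym orbb => /eqP ->; rewrite ij.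
  by rewrite noatom.
have [j jD] := atomD.
have -> : A = f @: [set bot; top; coat i; atom j].
  apply/setP; apply: fsurj => x; rewrite (mem_imset _ _ finj) !inE.
  have -> : (f x \in A) = (x \in D) by rewrite inE.
  elim/rankedP: x => [||k|k]; rewrite ?bD ?tD //.
    apply/idP/idP => [kD|/orP[]/eqP -> //].
    by have := Dch _ _ iD kD; rewrite /= eq_sym orbb => /eqP ->; rewrite eqxx.
  apply/idP/idP => [kD|/orP[]/eqP -> //].
  by have := Dch _ _ jD kD; rewrite /= eq_sym orbb => /eqP ->; rewrite eqxx.
by rewrite card_imset // -!setUA !cardsU1 !inE /= cards1.
Qed.

Lemma presented_rank3_lattice : rank3_lattice r #|C| #|J|.
Proof.
rewrite /rank3_lattice presented_lattice presented_graded presented_coatoms.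
by rewrite presented_atoms !card_imset ?eqxx // => x y /finj[].
Qed.

End Presented.

End Incidence.

(** * Isomorphisms of presented lattices, and existence of presentations *)

Section Classification.

Variables C J : finType.

(** The bounds are preserved. If a coatom went to an atom, an atom below it would go to an element
    below that atom other than the bottom, hence to the same atom, against injectivity. The other
    case is dual. *)
Lemma inc_le_coat_atom (h h' : J -> {set C}) (q : ranked C J -> ranked C J) :
  incidence h -> injective q ->
  (forall x y, inc_le h' (q x) (q y) = inc_le h x y) -> (forall y, exists x, q x = y) ->
  (forall i, exists i', q (coat J i) = coat J i') /\
  (forall j, exists j', q (atom C j) = atom C j').
Proof.
move=> [h1 h2 _] qinj qle qsurj.
have qb : q (bot C J) = bot C J.
  have [x qx] := qsurj (bot C J); have := qle (bot C J) x.
  by rewrite qx; case: (q _) => [[[]|]|].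
have qt : q (top C J) = top C J.
  have [x qx] := qsurj (top C J); have := qle x (top C J).
  by rewrite qx; case: (q _) => [[[]|]|]; elim/rankedP: x {qx}.
have qbot x : q x = bot C J -> x = bot C J by move=> E; apply: qinj; rewrite E qb.
have qtop x : q x = top C J -> x = top C J by move=> E; apply: qinj; rewrite E qt.
split=> [i|j].
  case qi: (q (coat J i)) => [[[i'|j']|]|]; last 2 first.
  - by have := qtop _ qi.
  - by have := qbot _ qi.
  - by exists i'.
  have [j ij] := h2 i; have := qle (atom C j) (coat J i); rewrite qi /= ij.
  case qj: (q (atom C j)) => [[[i''|j'']|]|] //=; last by have := qbot _ qj.
  by move/eqP => jj'; have /qinj : q (atom C j) = q (coat J i) by rewrite qi qj jj'.
case qj: (q (atom C j)) => [[[i'|j']|]|]; last 2 first.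
- by have := qtop _ qj.
- by have := qbot _ qj.
- have [i ij] := h1 j; have := qle (atom C j) (coat J i); rewrite qj /= ij.
  case qi: (q (coat J i)) => [[[i''|j'']|]|] //=; last by have := qtop _ qi.
  by move/eqP => ii'; have /qinj : q (atom C j) = q (coat J i) by rewrite qi qj ii'.
by exists j'.
Qed.

(** Read through the presentations, an isomorphism preserves levels and so splits into permutations
    of coatoms and atoms. Conversely such a pair extends by the identity on the bounds. *)
Lemma presented_isomorphic (T : finType) (G G' : {set T * T}) (h h' : J -> {set C}) f f' :
  incidence h -> presents (rel_of G) h f -> presents (rel_of G') h' f' ->
  isomorphic G G' <->
  exists (s : {perm C}) (t : {perm J}), forall j, h' (t j) = s @: h j.
Proof.
move=> hP [[g fK gK] fle] [[g' f'K g'K] f'le]; split=> [/existsP[p pP]|[s [t hst]]].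
  have ple x y : rel_of G' (p x) (p y) = rel_of G x y.
    by rewrite (eqP (forallP (forallP pP x) y)).
  pose q x := g' (p (f x)).
  have qK : cancel q (fun y => g (p^-1%g (f' y))).
    by move=> x; rewrite /q g'K permK fK.
  have qle x y : inc_le h' (q x) (q y) = inc_le h x y.
    by rewrite -f'le !g'K ple fle.
  have qsurj y : exists x, q x = y.
    by exists (g (p^-1%g (f' y))); rewrite /q gK permKV f'K.
  have [qC qJ] := inc_le_coat_atom hP (can_inj qK) qle qsurj.
  have [sf sfE] := fin_all_exists qC; have [tf tfE] := fin_all_exists qJ.
  have sinj : injective sf.
    move=> i i' ii'; have : q (coat J i) = q (coat J i') by rewrite !sfE ii'.
    by move/(can_inj qK) => -[].
  have tinj : injective tf.
    move=> j j' jj'; have : q (atom C j) = q (atom C j') by rewrite !tfE jj'.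
    by move/(can_inj qK) => -[].
  exists (perm sinj), (perm tinj) => j; rewrite permE; apply/setP => i.
  rewrite -(permKV (perm sinj) i) (mem_imset _ _ (@perm_inj _ _)).
  move: ((perm sinj)^-1%g i) => k; rewrite permE.
  by have := qle (atom C j) (coat J k); rewrite sfE tfE.
pose q (x : ranked C J) : ranked C J :=
  match x with
  | Some (Some (inl i)) => coat J (s i)
  | Some (Some (inr j)) => atom C (t j)
  | _ => x
  end.
have qinj : injective q.
  move=> [[[i|j]|]|] [[[i'|j']|]|] //= E; case: E => /perm_inj ->; reflexivity.
have qle x y : inc_le h' (q x) (q y) = inc_le h x y.
  elim/rankedP: x => [||i|j]; elim/rankedP: y => [||i'|j'] //=.
  - by rewrite (inj_eq perm_inj).
  - by rewrite hst (mem_imset _ _ (@perm_inj _ s)).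
  - by rewrite (inj_eq perm_inj).
have pinj : injective (fun x => f' (q (g x))).
  by move=> x y /(can_inj f'K) /qinj /(can_inj gK).
apply/existsP; exists (perm pinj); apply/forallP => x; apply/forallP => y.
by rewrite !permE f'le qle -fle !gK.
Qed.

Lemma exists_enumeration (T : finType) (I : finType) (A : {set T}) :
  #|A| = #|I| -> exists2 e : I -> T, injective e &
    forall x, (x \in A) <-> (exists i, x = e i).
Proof.
move=> AI; exists (fun i => enum_val (cast_ord (esym AI) (enum_rank i))).
  by move=> i i' /enum_val_inj/cast_ord_inj/enum_rank_inj.
move=> x; split=> [xA|[i ->]]; last exact: enum_valP.
exists (enum_val (cast_ord AI (enum_rank_in xA x))).
by rewrite enum_valK cast_ordK enum_rankK_in.
Qed.

(** Enumerating coatoms and atoms gives an injective map from [ranked], because chains of four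
    elements keep the levels apart. It is bijective by the count in [card_graded_rank3]. *)
Lemma rank3_lattice_presented (T : finType) (r : rel T) :
  0 < #|C| -> 0 < #|J| -> rank3_lattice r #|C| #|J| ->
  exists (h : {ffun J -> {set C}}) (f : ranked C J -> T), incidence h /\ presents r h f.
Proof.
move=> C0 J0 /and4P[latr rk3 /eqP coC /eqP atJ].
have cardT := card_graded_rank3 latr rk3.
have rxx x : r x x by case/andP: latr => /and3P[/forallP/(_ x)].
have ranti x y : r x y -> r y x -> x = y.
  move=> xy yx; case/andP: latr => /and3P[_ /forallP/(_ x)/forallP/(_ y)].
  by rewrite xy yx => /eqP.
have through x : exists D : {set T},
    [/\ x \in D, #|D| = 4 & forall y, y \in D -> r x y || r y x].
  have /maxset_exists[D mD /subsetP xD] : chain r [set x].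
    by apply/forall_inP => y /set1P->; apply/forall_inP => z /set1P->; rewrite rxx.
  have xinD : x \in D by apply: xD; rewrite inE.
  exists D; split=> //; first by apply/eqP; move/forallP: rk3 => /(_ D)/implyP; apply.
  by move=> y yD; have /forall_inP/(_ _ xinD)/forall_inP := maxsetp mD; apply.
(* A maximal chain through [x] gives four elements comparable to it. *)
have small x (A : {set T}) : #|A| < 4 ->
    (forall z, r x z || r z x -> z \in A) -> False.
  move=> A4 xA; have [D [xD D4 xcmp]] := through x.
  suff /subset_leq_card : D \subset A by rewrite D4 leqNgt A4.
  by apply/subsetP => z /xcmp; apply: xA.
have [co coinj coP] := exists_enumeration coC.
have [at_ atinj atP] := exists_enumeration atJ.
have [i0 _] := card_gt0P C0; have [j0 _] := card_gt0P J0.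
have [t tP] : exists t, is_top r t.
  have /coP : exists i, co i0 = co i by exists i0.
  by rewrite inE => /existsP[t /andP[]]; exists t.
have [b bP] : exists b, is_bottom r b.
  have /atP : exists i, at_ j0 = at_ i by exists j0.
  by rewrite inE => /existsP[b /andP[]]; exists b.
have {}tP x : r x t by apply: (forallP tP).
have {}bP x : r b x by apply: (forallP bP).
have cot i : covers r (co i) t.
  have /coP : exists k, co i = co k by exists i.
  rewrite inE => /existsP[t' /andP[/forallP/(_ t) tt']].
  by rewrite (ranti t t').
have atb j : covers r b (at_ j).
  have /atP : exists k, at_ j = at_ k by exists j.
  rewrite inE => /existsP[b' /andP[/forallP/(_ b) bb']].
  by rewrite (ranti b b').
have co_up i z : r (co i) z -> z = co i \/ z = t.
  have /and3P[_ _ /forallP/(_ z)] := cot i.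
  by rewrite tP andbT => /implyP h /h /orP[]/eqP; [left|right].
have at_down j z : r z (at_ j) -> z = b \/ z = at_ j.
  have /and3P[_ _ /forallP/(_ z)] := atb j.
  by rewrite bP => /implyP h /h /orP[]/eqP; [left|right].
have co_t i : co i <> t by have /and3P[_ /eqP] := cot i.
have at_b j : at_ j <> b by have /and3P[_ /eqP + _] := atb j => + /esym.
have bt : b <> t.
  move=> bt; apply: (at_b j0); apply: ranti => //; rewrite bt; exact: tP.
(* An element both atom and coatom would be comparable only to itself and the bounds. *)
have co_at i j : co i <> at_ j.
  move=> ij; apply: (small (co i) [set b; co i; t]).
    by rewrite -setUA cardsU1 cards2; case: (_ \notin _); case: (_ != _).
  move=> z /orP[/co_up[->|->]|]; rewrite ?inE ?eqxx ?orbT //.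
  by rewrite ij => /at_down[] ->; rewrite !eqxx ?orbT.
have nbt : ~ covers r b t.
  move=> /and3P[_ _ /forallP h]; apply: (small b [set b; t]).
    by rewrite cards2; case: (_ != _).
  by move=> z _; have := h z; rewrite bP tP !inE.
have co_b i : co i <> b by move=> cb; apply: nbt; rewrite -cb.
have at_t j : at_ j <> t by move=> at_t; apply: nbt; rewrite -at_t.
pose h := [ffun j => [set i | r (at_ j) (co i)]].
pose f (x : ranked C J) :=
  match x with
  | None => b
  | Some None => t
  | Some (Some (inl i)) => co i
  | Some (Some (inr j)) => at_ j
  end.
have finj : injective f.
  by elim/rankedP => [||i|j]; elim/rankedP => [||i'|j'] //= E;
    try by [have := bt; rewrite E | have := bt; rewrite -E | case: (co_b _ E)
      | case: (co_t _ E) | case: (at_b _ E) | case: (at_t _ E) | case: (co_at _ _ E)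
      | case: (co_b _ (esym E)) | case: (co_t _ (esym E)) | case: (at_b _ (esym E))
      | case: (at_t _ (esym E)) | case: (co_at _ _ (esym E))
      | rewrite (coinj _ _ E) | rewrite (atinj _ _ E)].
have fP : presents r h f.
  split.
    apply: inj_card_bij finj _.
    by rewrite !card_option card_sum cardT coC atJ addn2.
  elim/rankedP => [||i|j] y; rewrite ?bP //.
    elim/rankedP: y => [||i|j] /=; rewrite ?rxx //; apply/negbTE/negP => ty.
    - exact: bt (ranti _ _ (bP t) ty).
    - exact: co_t (ranti _ _ (tP _) ty).
    - exact: at_t (ranti _ _ (tP _) ty).
  - elim/rankedP: y => [||i'|j] /=; rewrite ?tP //.
    + by apply/negbTE/negP => /ranti/(_ (bP _))/co_b.
    + by apply/idP/eqP => [/co_up[/coinj->|/co_t]//|->].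
    + by apply/negbTE/negP => /co_up[/esym/co_at|/at_t].
  - elim/rankedP: y => [||i|j'] /=; rewrite ?tP //.
    + by apply/negbTE/negP => /ranti/(_ (bP _))/at_b.
    + by rewrite ffunE inE.
    + by apply/idP/eqP => [/at_down[/at_b|/atinj->]//|->].
exists h, f; split=> //.
have [[g fK gK] fle] := fP.
(* A chain of four through an atom has an element besides it and the two bounds, which must be a
   coatom above it; dually for a coatom. *)
have middle x y z : exists w, r x w || r w x /\ w \notin [set x; y; z].
  have [D [xD D4 xcmp]] := through x.
  have [w] : exists w, w \in D :\: [set x; y; z].
    apply/set0Pn; rewrite setD_eq0; apply/negP => /subset_leq_card.
    by rewrite D4 -setUA cardsU1 cards2; case: (_ \notin _); case: (_ != _).
  by rewrite inE => /andP[wn wD]; exists w; split=> //; apply: xcmp.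
split.
- move=> j; have [w []] := middle (at_ j) b t.
  rewrite !inE -[w]gK -[at_ j]/(f (atom C j)) -[b]/(f (bot C J)) -[t]/(f (top C J)).
  rewrite !fle !(inj_eq finj); elim/rankedP: (g w) => [||i|j'] //=.
    by rewrite orbF => ji _; exists i.
  by rewrite eq_sym orbb => /eqP ->; rewrite eqxx.
- move=> i; have [w []] := middle (co i) b t.
  rewrite !inE -[w]gK -[co i]/(f (coat J i)) -[b]/(f (bot C J)) -[t]/(f (top C J)).
  rewrite !fle !(inj_eq finj); elim/rankedP: (g w) => [||i'|j] //=.
    by rewrite eq_sym orbb => /eqP ->; rewrite eqxx.
  by move=> ij _; exists j.
move=> j j' i i' ij ij' i'j i'j'.
(* The join of the two atoms lies below both coatoms. If it is a coatom, it equals both coatoms; if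
   it is an atom, it equals both atoms. *)
case/andP: latr => _ /forallP/(_ (at_ j))/forallP/(_ (at_ j'))/andP[/existsP[z + ] _].
move=> /and3P[jz j'z /forallP zmin].
have := zmin (co i); have := zmin (co i'); move: jz j'z.
rewrite -[z]gK -[at_ j]/(f (atom C j)) -[at_ j']/(f (atom C j')).
rewrite -[co i]/(f (coat J i)) -[co i']/(f (coat J i')) !fle /=.
rewrite ij ij' i'j i'j' /=; elim/rankedP: (g z) => [||k|k] //=.
  by move=> _ _ /eqP -> /eqP ->; rewrite eqxx orbT.
by move=> /eqP -> /eqP ->; rewrite eqxx.
Qed.

End Classification.

(** * Maps up to permutation of their source *)

Section Fibers.

Variables (U : finType) (a : nat).
Implicit Types h : 'I_a -> U.

Definition fiber_card h u := #|[set j | h j == u]|.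

Lemma fiber_card_count h u : fiber_card h u = count_mem u (codom h).
Proof.
rewrite /fiber_card cardsE cardE -size_filter filter_map size_map.
by congr (size _); rewrite enumT; apply: eq_filter.
Qed.

Lemma fiber_card_gt0 h u : (0 < fiber_card h u) = [exists j, h j == u].
Proof.
rewrite card_gt0; apply/set0Pn/existsP => -[j]; rewrite ?inE => ju; exists j => //.
by rewrite inE.
Qed.

Lemma fiber_card_leq h u : fiber_card h u <= a.
Proof. by rewrite -[leqRHS]card_ord max_card. Qed.

(** Fibre sizes are multiplicities in the list of values, so equal sizes make the two lists
    permutations of each other. *)
Lemma fiber_card_perm h h' :
  fiber_card h =1 fiber_card h' -> exists t : {perm 'I_a}, forall j, h' (t j) = h j.
Proof.
move=> hh'; have : perm_eq (codom h) [tuple h' j | j < a].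
  by apply/allP => u _ /=; rewrite -fiber_card_count hh' fiber_card_count.
move=> /tuple_permP[t tE]; exists t => j.
have := congr1 (fun s => nth (h j) s j) tE.
rewrite -[codom h]/(val [tuple h j | j < a]) -!tnth_nth !tnth_mktuple.
by move=> ->.
Qed.

End Fibers.

(** * Incidence structures up to relabelling of atoms, as models *)

Section Profiles.

Variables (C : finType) (a : nat).
Implicit Types (h : 'I_a -> {set C}) (s : {perm C}) (S : {set C}).

(** By [incidence_inj] a set of at least two coatoms comes from at most one atom, so a set of lines
    records these without loss. Only singletons need multiplicities. *)
Definition profile h : model C a :=
  ([set S : {set C} | (1 < #|S|) && (0 < fiber_card h S)],
   [ffun i => inord (fiber_card h [set i])]).

Lemma profile2E h i : (profile h).2 i = fiber_card h [set i] :> nat.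
Proof. by rewrite ffunE inordK // ltnS fiber_card_leq. Qed.

Lemma incidence_inj h j j' :
  incidence h -> h j = h j' -> 1 < #|h j| -> j = j'.
Proof.
move=> [_ _ h3] hj /card_gt1P[x [y [xj yj xy]]].
have := h3 j j' x y; rewrite -hj xj yj (negPf xy) orbF.
by move=> /(_ isT isT isT isT)/eqP.
Qed.

(** The profile determines every fibre size: the sum accounts for singletons, the membership for
    larger sets, whose fibres have at most one element. *)
Lemma fiber_card_profile h S : incidence h -> S != set0 ->
  fiber_card h S = (S \in (profile h).1) + \sum_i (S == [set i]) * (profile h).2 i.
Proof.
move=> hP S0; rewrite inE; have [S1|S1] := leqP #|S| 1.
  have /cards1P[i ->] : #|S| == 1 by rewrite eqn_leq S1 card_gt0.
  rewrite add0n (bigD1 i) //= eqxx mul1n profile2E big1 ?addn0 // => k ki.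
  by rewrite (inj_eq set1_inj) eq_sym (negPf ki).
rewrite [X in _ + X]big1 ?addn0 => [|i _]; last first.
  by case: eqP => // Si; rewrite Si cards1 in S1.
case: posnP => [-> //|]; rewrite fiber_card_gt0 => /existsP[j /eqP jS].
apply/eqP/cards1P; exists j; apply/setP => k; rewrite !inE.
apply/eqP/eqP => [kS|-> //]; apply: (incidence_inj hP); rewrite kS ?jS //.
Qed.

Lemma profile_models h : incidence h -> profile h \in models C a.
Proof.
move=> hP; have [h1 h2 h3] := hP; rewrite inE; apply/and3P; split.
- apply/linear_spaceP; split=> [S|S S']; rewrite inE => /andP[] //.
  rewrite fiber_card_gt0 => S1 /existsP[j /eqP jS].
  rewrite inE => /andP[S'1]; rewrite fiber_card_gt0 => /existsP[j' /eqP jS'] SS'.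
  rewrite leqNgt; apply/negP => /card_gt1P[x [y []]]; rewrite !inE -jS -jS'.
  move=> /andP[xj xj'] /andP[yj yj'] xy; have := h3 _ _ _ _ xj xj' yj yj'.
  rewrite (negPf xy) orbF => /eqP jj'.
  by rewrite -jS -jS' jj' eqxx in SS'.
- apply/forallP => i; have [j ij] := h2 i; have [hj1|hj1] := leqP #|h j| 1.
    rewrite profile2E fiber_card_gt0; apply/orP; right; apply/existsP; exists j.
    by rewrite eq_sym eqEcard sub1set ij cards1.
  apply/orP; left; apply/bigcupP; exists (h j) => //.
  by rewrite inE hj1 fiber_card_gt0; apply/existsP; exists j.
(* The second component of the total: each of the [a] atoms lies in one fibre, the fibre of the
   empty set being empty. *)
have cardJ : \sum_(S : {set C}) fiber_card h S = a.
  rewrite -[RHS]card_ord -sum1_card (partition_big h xpredT) //=.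
  by apply: eq_bigr => S _; rewrite sum1_card /fiber_card cardsE.
rewrite -[X in _ == X]cardJ (bigD1 set0) //= (_ : fiber_card h set0 = 0) ?add0n.
  rewrite (eq_bigr _ (fun S => @fiber_card_profile h S hP)) big_split /=.
  rewrite -big_mkcondr sum1dep_card exchange_big /=; apply/eqP; congr (_ + _).
    by apply: eq_card => S; rewrite !inE; case: eqP => // ->; rewrite cards0.
  apply: eq_bigr => i _; rewrite (bigD1 [set i]) /=; last first.
    by rewrite -card_gt0 cards1.
  by rewrite eqxx mul1n big1 ?addn0 // => S /andP[_ /negPf ->].
apply/eqP; rewrite -leqn0 leqNgt fiber_card_gt0; apply/existsP => -[j /eqP j0].
by have [i +] := h1 j; rewrite j0 inE.
Qed.

Let permS s S : exists S0, S = s @: S0.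
Proof.
exists (s^-1%g @: S); rewrite -imset_comp -[LHS]imset_id.
by apply: eq_imset => i /=; rewrite permKV.
Qed.

(** Fibre sizes ignore the permutation of atoms and are carried along by that of coatoms.
    Conversely, matching profiles give matching fibre sizes, and [fiber_card_perm] supplies the
    permutation of atoms. *)
Lemma profile_orbit h h' : incidence h -> incidence h' ->
  (exists s (t : {perm 'I_a}), forall j, h' (t j) = s @: h j) <->
  (exists s, model_perm (profile h) s = profile h').
Proof.
move=> hP h'P; split=> [[s [t hst]]|[s sE]]; exists s.
  have cE S : fiber_card h' (s @: S) = fiber_card h S.
    rewrite /fiber_card -(card_preimset _ (@perm_inj _ t)); apply: eq_card => j.
    by rewrite !inE hst (inj_eq (imset_inj (@perm_inj _ s))).
  congr (_, _).
    apply/setP => S; have [S0 ->] := permS s S.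
    rewrite (mem_imset _ _ (imset_inj (@perm_inj _ s))) !inE cE.
    by rewrite card_imset //; apply: perm_inj.
  apply/ffunP => i; rewrite ffunE; apply: ord_inj; rewrite !profile2E -cE.
  by rewrite imset_set1 permKV.
have fib0 g : incidence g -> fiber_card g set0 = 0.
  move=> [g1 _ _]; apply/eqP; rewrite -leqn0 leqNgt fiber_card_gt0.
  by apply/existsP => -[j /eqP j0]; have [i +] := g1 j; rewrite j0 inE.
have [|t tE] := @fiber_card_perm _ _ (fun j => s @: h j) h'; last by exists t.
move=> S; have [S0 ->] := permS s S.
transitivity (fiber_card h S0).
  by apply: eq_card => j; rewrite !inE (inj_eq (imset_inj (@perm_inj _ s))).
have [->|S00] := eqVneq S0 set0; first by rewrite imset0 !fib0.
rewrite !fiber_card_profile ?imset_eq0 // -sE /=; congr (_ + _).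
  by rewrite (mem_imset _ _ (imset_inj (@perm_inj _ s))).
rewrite [RHS](reindex_inj (@perm_inj _ s)) /=; apply: eq_bigr => i _.
by rewrite [in RHS]ffunE permK -imset_set1 (inj_eq (imset_inj (@perm_inj _ s))).
Qed.

Lemma models_profile x : x \in models C a -> exists h, incidence h /\ profile h = x.
Proof.
case: x => L m; rewrite inE => /and3P[/= /linear_spaceP[L1 L2] covL /eqP sumL].
(* One atom per line and [m i] atoms below [i] alone; the condition on the sum says that this makes
   [a] atoms. *)
pose sq := enum L ++ flatten [seq nseq (m i) [set i] | i <- enum C].
have szsq : size sq == a.
  apply/eqP; rewrite -[RHS]sumL size_cat -cardE size_flatten /shape -map_comp.
  rewrite sumnE big_map big_enum /=; congr (_ + _).
  by apply: eq_bigr => i _; rewrite size_nseq.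
pose h := tnth (Tuple szsq).
have cE S : fiber_card h S = (S \in L) + \sum_i (S == [set i]) * m i.
  rewrite fiber_card_count.
  have -> : codom h = sq.
    by rewrite -[RHS]/(tval (Tuple szsq)) -map_tnth_enum.
  rewrite count_cat count_uniq_mem ?enum_uniq //.
  rewrite mem_enum count_flatten -map_comp sumnE big_map big_enum /=; congr (_ + _).
  by apply: eq_bigr => i _; rewrite count_nseq /= eq_sym.
have c1 i : fiber_card h [set i] = m i.
  rewrite cE (bigD1 i) //= eqxx mul1n big1 => [|k ki].
    rewrite addn0; case: (boolP (_ \in L)) => // /L1; by rewrite cards1.
  by rewrite (inj_eq set1_inj) eq_sym (negPf ki).
have cL S : 1 < #|S| -> fiber_card h S = (S \in L).
  move=> S1; rewrite cE big1 ?addn0 // => i _.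
  by case: eqP => // Si; rewrite Si cards1 in S1.
have fib S : 0 < fiber_card h S -> exists j, h j = S.
  by rewrite fiber_card_gt0 => /existsP[j /eqP]; exists j.
have fibh j : 0 < fiber_card h (h j).
  by rewrite fiber_card_gt0; apply/existsP; exists j.
exists h; split.
  split.
  - move=> j; apply/set0Pn; apply/negP => /eqP j0; have := fibh j.
    rewrite j0 cE big1 ?addn0 => [|i _]; last first.
      by case: eqP => // /esym/eqP; rewrite -cards_eq0 cards1.
    by case: (boolP (_ \in L)) => // /L1; rewrite cards0.
  - move=> i; have /orP[/bigcupP[S SL iS]|mi] := forallP covL i.
      by have [|j jS] := fib S; [rewrite cL ?SL ?L1 | exists j; rewrite jS].
    by have [|j jS] := fib [set i]; [rewrite c1 | exists j; rewrite jS inE].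
  move=> j j' i i' ij ij' i'j i'j'; case: (eqVneq i i') => [_|ii']; rewrite ?orbT //.
  have j1 : 1 < #|h j| by apply/card_gt1P; exists i, i'.
  have j'1 : 1 < #|h j'| by apply/card_gt1P; exists i, i'.
  have jL : h j \in L by have := fibh j; rewrite cL //; case: (_ \in _).
  have j'L : h j' \in L by have := fibh j'; rewrite cL //; case: (_ \in _).
  (* Two atoms sharing two coatoms carry the same line, and each line is listed once. *)
  have jj' : h j = h j'.
    apply/eqP; apply: contraT => /(L2 _ _ jL j'L); rewrite leqNgt => /negP[].
    by apply/card_gt1P; exists i, i'; rewrite !inE ij ij' i'j i'j'.
  have /eqP/cards1P[k kE] : fiber_card h (h j) = 1 by rewrite cL ?jL.
  have : j \in [set k] by rewrite -kE inE.
  have : j' \in [set k] by rewrite -kE inE jj'.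
  by rewrite !inE => /eqP -> /eqP ->; rewrite eqxx.
congr (_, _); last by apply/ffunP => i; apply: val_inj; rewrite /= -c1 profile2E.
apply/setP => S; rewrite inE; have [S1|S1] := boolP (1 < #|S|).
  by rewrite cL //; case: (_ \in _).
by symmetry; apply: contraNF S1; apply: L1.
Qed.

End Profiles.

(** * Isomorphism classes of lattices matched with orbits of models *)

Lemma leq_card_rel (T T' : finType) (A : {set T}) (B : {set T'}) (R : T -> T' -> Prop) :
  (forall x, x \in A -> exists2 y, y \in B & R x y) ->
  (forall x x' y, R x y -> R x' y -> x = x') -> #|A| <= #|B|.
Proof.
move=> AB Rinj; have [->|/set0Pn[x0 /AB[y0 _ _]]] := eqVneq A set0.
  by rewrite cards0.
have [x|f fP] := @fin_all_exists _ (fun=> T')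
    (fun x y => x \in A -> y \in B /\ R x y).
  have [xA|nxA] := boolP (x \in A); last by exists y0.
  by have [y] := AB x xA; exists y.
rewrite -(@card_in_imset _ _ f A) => [|x x' xA x'A fxx'].
  by apply/subset_leq_card/subsetP => _ /imsetP[x /fP[fB _] ->].
have [_ Rx] := fP x xA; have [_ Rx'] := fP x' x'A.
by apply: Rinj Rx _; rewrite fxx'.
Qed.

(** [encodes] relates every lattice to some model and every model to some lattice, and by [compat]
    it turns isomorphism into lying in one orbit. Hence [leq_card_rel] applies in both
    directions. *)
Lemma num_rank3_lattices_orbits c a : 0 < c -> 0 < a ->
  num_rank3_lattices c a =
  #|[set orbit (@model_action 'I_c a) [set: {perm 'I_c}] x | x in models 'I_c a]|.
Proof.
move=> c0 a0; set D := rank3_lattices c a; pose T := 'I_(c + a + 2).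
pose cls (G : {set T * T}) := [set G' in D | isomorphic G G'].
pose orb := orbit (@model_action 'I_c a) [set: {perm 'I_c}].
pose encodes (G : {set T * T}) x := exists (h : 'I_a -> {set 'I_c}) f,
  [/\ incidence h, presents (rel_of G) h f & profile h = x].
have compat G G' x x' : encodes G x -> encodes G' x' ->
    isomorphic G G' <-> orb x = orb x'.
  move=> [h [f [hP fP <-]]] [h' [f' [h'P f'P <-]]].
  rewrite (presented_isomorphic hP fP f'P) profile_orbit //; split=> [[s sE]|].
    apply/esym/orbit_eqP/orbitP; exists s => //; exact: in_setT.
  by move=> /esym/orbit_eqP/orbitP[s _ sE]; exists s.
have clsP G G' : (G' \in cls G) = (G' \in D) && isomorphic G G'.
  by rewrite [LHS]in_set.
have clsE G G' : G \in D -> G' \in D -> cls G = cls G' <-> isomorphic G G'.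
  move=> GD G'D; split=> [/setP/(_ G')|GG'].
    by rewrite !clsP G'D (isomorphic_equiv G G G').1.
  by apply/setP => K; rewrite !clsP (isomorphic_equiv G G' K).2.
have card_ranked : #|ranked 'I_c 'I_a| = #|T|.
  by rewrite !card_option card_sum !card_ord addn2.
have encode G : G \in D -> exists2 x, x \in models 'I_c a & encodes G x.
  rewrite inE => GD; have := @rank3_lattice_presented 'I_c 'I_a T (rel_of G).
  rewrite !card_ord => /(_ c0 a0 GD)[h [f [hP fP]]].
  by exists (profile h); [apply: profile_models | exists h, f].
have decode x : x \in models 'I_c a -> exists2 G, G \in D & encodes G x.
  move=> /models_profile[h [hP hx]].
  (* The carrier and [ranked] have equally many elements, so the order [inc_le h] is transported
     along their enumerations. *)
  pose f y : T := enum_val (cast_ord card_ranked (enum_rank y)).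
  pose g y : ranked 'I_c 'I_a := enum_val (cast_ord (esym card_ranked) (enum_rank y)).
  have fK : cancel f g by move=> y; rewrite /f /g enum_valK cast_ordK enum_rankK.
  have gK : cancel g f by move=> y; rewrite /f /g enum_valK cast_ordKV enum_rankK.
  pose G : {set T * T} := [set p | inc_le h (g p.1) (g p.2)].
  have fP : presents (rel_of G) h f.
    by split=> [|y z]; [exists g | rewrite /rel_of /= inE /= !fK].
  exists G; last by exists h, f.
  have := @presented_rank3_lattice 'I_c 'I_a _ _ h f; rewrite !card_ord.
  by rewrite inE; apply.
pose R (u : {set {set T * T}}) (v : {set model 'I_c a}) :=
  exists G x, [/\ G \in D, u = cls G, v = orb x & encodes G x].
apply/eqP; rewrite eqn_leq; apply/andP; split.
  apply: (@leq_card_rel _ _ _ _ R) => [_ /imsetP[G GD ->]|u u' v].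
    have [x xM Gx] := encode G GD; exists (orb x); first exact: imset_f.
    by exists G, x.
  move=> [G [x [GD -> -> Gx]]] [G' [x' [G'D -> xx' G'x']]].
  by apply/(clsE _ _ GD G'D)/(compat _ _ _ _ Gx G'x').
apply: (@leq_card_rel _ _ _ _ (fun v u => R u v)) => [_ /imsetP[x xM ->]|v v' u].
  have [G GD Gx] := decode x xM; exists (cls G); first exact: imset_f.
  by exists G, x.
move=> [G [x [GD -> -> Gx]]] [G' [x' [G'D GG' -> G'x']]].
by apply/(compat _ _ _ _ Gx G'x')/(clsE _ _ GD G'D).
Qed.

Theorem proposition7p3 (R : realType) (c : nat) (hc : (1 <= c)%N) :
  exists f : nat -> R[i],
    quasipolynomial (\big[lcmn/1%N]_(1 <= i < c.+1) i) f /\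
    forall a : nat, (1 <= a)%N -> ('C(c, 2) <= a)%N ->
      (num_rank3_lattices c a)%:R%R = f a.
Proof.
set N := \big[lcmn/1%N]_(1 <= i < c.+1) i.
have N0 : 0 < N.
  rewrite /N big_seq; elim/big_ind: _ => // [x y x0 y0|i].
    by rewrite lcmn_gt0 x0.
  by rewrite mem_index_iota => /andP[].
have dvdN l : 0 < l <= c -> l %| N.
  move=> /andP[l0 lc]; rewrite /N big_add1 /= big_mkord.
  have ltl : l.-1 < c by rewrite prednK.
  by apply: (biglcmn_sup (Ordinal ltl)); rewrite //= prednK.
have q : quasi_on (fun a => (0 < a) && ('C(c, 2) <= a)) N
    (fun a => (num_rank3_lattices c a)%:R%R : R[i]).
  have := @quasi_on_orbits 'I_c R[i] N N0; rewrite card_ord.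
  move=> /(_ hc dvdN); apply: eq_quasi_on => a /andP[a0 _].
  by rewrite num_rank3_lattices_orbits.
have [f [fN Ff]] := quasi_on_extend N0 q; exists f; split=> // a a0 ca.
by rewrite -Ff // unfold_in a0.
Qed.
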